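(* Let $\eta$ be a link function for binary responses whose inverse $\eta^{-1}:\mathbb{R}\to(0,1)$ is strictly increasing and satisfies $1-\eta^{-1}(u)=\eta^{-1}(-u)$ for all $u\in\mathbb{R}$. Consider the neural generalized mixed-effects model with binary responses in $\{0,1\}$ and link $\eta$, and, for an observation with covariates $x\in\mathbb{R}^p$ in a new group (a group with no observed data) with group covariates $z\in\mathbb{R}^q$, let $$p(y=1\mid x,z)=\int_{\mathbb{R}^k}\eta^{-1}\bigl(f_\theta(x)+\langle g_\psi(z),\gamma\rangle\bigr)\,\phi_k(\gamma)\,d\gamma,\qquad p(y=0\mid x,z)=1-p(y=1\mid x,z).$$ Then the Bayes-optimal classifier $$\hat y(x,z)=\arg\max_{c\in\{0,1\}}p(y=c\mid x,z)$$ depends only on the fixed-effects term $f_\theta(x)$ and does not depend on $g_\psi(z)$. That is, there is a map $D$ from $\mathbb{R}$ to the nonempty subsets of $\{0,1\}$, depending only on $\eta$, such that for all functions $f_\theta:\mathbb{R}^p\to\mathbb{R}$ and $g_\psi:\mathbb{R}^q\to\mathbb{R}^k$ and all $x\in\mathbb{R}^p$, $z\in\mathbb{R}^q$, the set of maximizers of $c\mapsto p(y=c\mid x,z)$ over $\{0,1\}$ equals $D(f_\theta(x))$.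
   Context: The neural generalized mixed-effects model (NGMM): for observation $i$ in group $j$, with covariates $x_{ij}\in\mathbb{R}^p$, group covariates $z_j\in\mathbb{R}^q$ (common to all observations in the group) and latent random effect $\gamma_j\sim\mathcal{N}(0,I_k)$, the conditional mean of the response is $\mathbb{E}[y_{ij}\mid x_{ij},z_j,\gamma_j]=\eta^{-1}\bigl(f_\theta(x_{ij})+\langle g_\psi(z_j),\gamma_j\rangle\bigr)$, where $f_\theta:\mathbb{R}^p\to\mathbb{R}$ and $g_\psi:\mathbb{R}^q\to\mathbb{R}^k$ are functions (neural networks with parameters $\theta,\psi$) and $\langle\cdot,\cdot\rangle$ is the Euclidean inner product. For binary responses this mean is the conditional probability that $y_{ij}=1$. For a new group, the distribution of the random effect is its prior $\mathcal{N}(0,I_k)$, so the predictive probability is the displayed integral. $\phi_k$ denotes the density of $\mathcal{N}(0,I_k)$ on $\mathbb{R}^k$. The argmax is understood as the set of maximizers (ties allowed). *)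

(* Defs.v *)
From HB Require Import structures.
From mathcomp Require Import all_boot all_order all_algebra.
From mathcomp Require Import all_classical all_reals all_analysis.
Set Implicit Arguments.
Unset Strict Implicit.
Unset Printing Implicit Defensive.
Import Order.TTheory GRing.Theory Num.Theory.
Import numFieldNormedType.Exports.
Local Open Scope classical_set_scope.
Local Open Scope ring_scope.

(* R^n is the type of n-tuples, which the library equips with the sigma-algebra
   generated by the coordinates. *)
Notation Rn R n := (n.-tuple (measurableTypeR R)).

(* Lebesgue measure on R^n is built by recursion on n: the image of the product
   of the one-dimensional Lebesgue measure and the Lebesgue measure on R^n under
   (x, t) |-> x :: t; on the one-point space R^0 it is the unit mass.
   See lebesgue_tupleX for its value on boxes. *)
Section lebesgue_cons.
Context (R : realType) (n : nat).
Local Notation T := (measurableTypeR R).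

Definition cons_pair (x : T * Rn R n) : Rn R n.+1 := [tuple of x.1 :: x.2].

Definition uncons_pair (t : Rn R n.+1) : T * Rn R n :=
  (thead t, [tuple of behead t]).

Lemma cons_pairK : cancel cons_pair uncons_pair.
Proof.
move=> [x t]; rewrite /uncons_pair /cons_pair/= theadE; congr pair.
exact: val_inj.
Qed.

Lemma measurable_cons_pair : measurable_fun [set: T * Rn R n] cons_pair.
Proof. exact: measurable_cons. Qed.

Lemma measurable_uncons_pair : measurable_fun [set: Rn R n.+1] uncons_pair.
Proof.
apply/measurable_fun_pair; last exact: measurable_behead.
exact: measurable_tnth.
Qed.

Variable m : {sigma_finite_measure set (Rn R n) -> \bar R}.

Definition lebesgue_cons : set (Rn R n.+1) -> \bar R :=
  pushforward (@lebesgue_measure R \x m)%E cons_pair.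

Let lebesgue_cons0 : lebesgue_cons set0 = 0%E.
Proof. by rewrite /lebesgue_cons /pushforward preimage_set0 measure0. Qed.

Let lebesgue_cons_ge0 A : (0 <= lebesgue_cons A)%E.
Proof. by rewrite /lebesgue_cons /pushforward measure_ge0. Qed.

Let lebesgue_cons_sigma_additive : semi_sigma_additive lebesgue_cons.
Proof.
have mcons (A : set (Rn R n.+1)) : measurable A -> measurable (cons_pair @^-1` A).
  by move=> mA; rewrite -[X in measurable X]setTI; exact: measurable_cons_pair.
move=> F mF tF mUF; rewrite /lebesgue_cons /pushforward preimage_bigcup.
apply: measure_semi_sigma_additive => [i||]; first exact: mcons.
- apply/trivIsetP => i j _ _ ij; rewrite -preimage_setI.
  by move/trivIsetP : tF => /(_ _ _ _ _ ij) ->//; rewrite preimage_set0.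
- by rewrite -preimage_bigcup; exact: mcons.
Qed.

HB.instance Definition _ := isMeasure.Build _ _ _ lebesgue_cons
  lebesgue_cons0 lebesgue_cons_ge0 lebesgue_cons_sigma_additive.

Let lebesgue_cons_sigma_finite : sigma_finite setT lebesgue_cons.
Proof.
have /sigma_finiteP[F [FT ndF Foo]] := sigma_finiteT (@lebesgue_measure R).
have /sigma_finiteP[G [GT ndG Goo]] := sigma_finiteT m.
exists (fun i => uncons_pair @^-1` (F i `*` G i)).
  rewrite -preimage_bigcup; apply/esym/seteqP; split => // t _ /=.
  have: setT (uncons_pair t).1 by []; rewrite {1}FT => -[i _ Fi].
  have: setT (uncons_pair t).2 by []; rewrite {1}GT => -[j _ Gj].
  exists (maxn i j) => //; split.
    by move: Fi; exact/subsetPset/ndF/leq_maxl.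
  by move: Gj; exact/subsetPset/ndG/leq_maxr.
move=> i; have [mF Fi] := Foo i; have [mG Gi] := Goo i; split.
  rewrite -[X in measurable X]setTI; apply: measurable_uncons_pair => //.
  exact: measurableX.
rewrite /lebesgue_cons /pushforward -comp_preimage.
rewrite (_ : _ \o _ = id); last exact/funext/cons_pairK.
by rewrite preimage_id product_measure1E// lte_mul_pinfty// ge0_fin_numE.
Qed.

HB.instance Definition _ := Measure_isSigmaFinite.Build _ _ _ lebesgue_cons
  lebesgue_cons_sigma_finite.

End lebesgue_cons.

Fixpoint lebesgue_tuple (R : realType) (n : nat) :
    {sigma_finite_measure set (Rn R n) -> \bar R} :=
  match n with
  | 0 => @dirac _ (Rn R 0) [tuple] R
  | n'.+1 => lebesgue_cons (lebesgue_tuple R n')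
  end.

Lemma lebesgue_tupleX (R : realType) (n : nat)
    (A : 'I_n -> set (measurableTypeR R)) : (forall i, measurable (A i)) ->
  lebesgue_tuple R n [set t | forall i, A i (tnth t i)] =
  (\prod_(i < n) lebesgue_measure (A i))%E.
Proof.
elim: n A => [|n IHn] A mA.
  by rewrite big_ord0 /= diracE mem_set// => -[].
rewrite big_ord_recl /= /lebesgue_cons /pushforward.
rewrite (_ : _ @^-1` _ =
    A ord0 `*` [set t : Rn R n | forall i, A (lift ord0 i) (tnth t i)]).
  rewrite product_measure1E//.
    by congr (_ * _)%E; apply: (IHn (fun i => A (lift ord0 i))).
  rewrite (_ : mkset _ = \bigcap_(i in [set: 'I_n])
      ((fun t : Rn R n => tnth t i) @^-1` A (lift ord0 i))).
    apply: fin_bigcap_measurable; first exact: finite_finset. move=> i _.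
    by rewrite -[X in measurable X]setTI; exact: measurable_tnth.
  by apply/seteqP; split => t /= tA i => [_|]; exact: tA.
apply/seteqP; split => [[x t]/= tA|[x t]/= [xA tA] i].
  by split => [|i]; [have := tA ord0|have := tA (lift ord0 i); rewrite tnthS].
by case: (unliftP ord0 i) => [j|] ->//; rewrite tnthS.
Qed.

(* The link function eta is only meaningful on ]0, 1[; etainv is its inverse,
   with values in ]0, 1[. *)
Definition inverse_link (R : realType) (eta etainv : R -> R) : Prop :=
  [/\ forall u, 0 < etainv u < 1,
      forall u, eta (etainv u) = u &
      forall m, 0 < m < 1 -> etainv (eta m) = m].

Definition inner (R : realType) (k : nat) (u v : Rn R k) : R :=
  \sum_(i < k) tnth u i * tnth v i.

(* Density of N(0, I_k). *)
Definition std_normal_pdf (R : realType) (k : nat) (g : Rn R k) : R :=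
  (2 * pi) `^ (- (k%:R / 2)) * expR (- (inner g g / 2)).

Section ngmm.
Context (R : realType) (p q k : nat).
Variables (etainv : R -> R) (f : Rn R p -> R) (g : Rn R q -> Rn R k).

Definition cond_mean (x : Rn R p) (z : Rn R q) (gamma : Rn R k) : R :=
  etainv (f x + inner (g z) gamma).

Definition new_group_prob1 (x : Rn R p) (z : Rn R q) : R :=
  \int[lebesgue_tuple R k]_gamma
    (cond_mean x z gamma * std_normal_pdf gamma).

(* The response set {0, 1} is bool, with true standing for 1. *)
Definition new_group_prob (x : Rn R p) (z : Rn R q) (c : bool) : R :=
  if c then new_group_prob1 x z else 1 - new_group_prob1 x z.

Definition bayes_classifier (x : Rn R p) (z : Rn R q) : set bool :=
  [set c | forall c', new_group_prob x z c' <= new_group_prob x z c].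

End ngmm.

(* Main.v *)
(** Since [1 - etainv u = etainv (- u)] and both the Lebesgue measure and the
    Gaussian density are invariant under [gamma |-> - gamma], flipping the
    response amounts to flipping the sign of the fixed effect:
    [p (y = 0)] is the integral defining [p (y = 1)] with [- f x] in place of
    [f x].  This integral is strictly increasing in the fixed effect, so
    [p (y = 0) <= p (y = 1)] if and only if [0 <= f x], whatever [g z] is. *)
Require Import Defs.
From HB Require Import structures.
From mathcomp Require Import all_boot all_order all_algebra.
From mathcomp Require Import all_classical all_reals all_analysis.
From mathcomp Require Import measurable_realfun lra.
Import Order.TTheory GRing.Theory Num.Theory.
Import numFieldNormedType.Exports.
Local Open Scope classical_set_scope.
Local Open Scope ring_scope.

(** * Reflection of tuples and the Gaussian density *)

Definition tuple_opp {R : realType} {n : nat} (t : Rn R n) : Rn R n :=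
  [tuple of map (fun x => - x) t].

Lemma measurable_tuple_opp (R : realType) (n : nat) :
  measurable_fun [set: Rn R n] (@tuple_opp R n).
Proof.
apply/measurable_fun_tnthP => i /=.
rewrite (_ : _ \o _ = -%R \o (fun t : Rn R n => tnth t i)); last first.
  by apply/funext => t /=; rewrite tnth_map.
by apply: measurable_funN; exact: measurable_tnth.
Qed.

Lemma inner_oppr (R : realType) (n : nat) (u v : Rn R n) :
  inner u (tuple_opp v) = - inner u v.
Proof.
by rewrite /inner -sumrN; apply: eq_bigr => i _; rewrite tnth_map mulrN.
Qed.

Lemma inner_oppl (R : realType) (n : nat) (u v : Rn R n) :
  inner (tuple_opp u) v = - inner u v.
Proof.
by rewrite /inner -sumrN; apply: eq_bigr => i _; rewrite tnth_map mulNr.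
Qed.

Lemma measurable_inner (R : realType) (n : nat) (D : set (Rn R n))
    (u v : Rn R n -> Rn R n) :
    (forall i, measurable_fun D (fun t => tnth (u t) i)) ->
    (forall i, measurable_fun D (fun t => tnth (v t) i)) ->
  measurable_fun D (fun t => inner (u t) (v t)).
Proof.
move=> mu mv; apply: measurable_sum => i.
by apply: measurable_funM; [exact: mu|exact: mv].
Qed.

Lemma measurable_std_normal_pdf (R : realType) (n : nat) :
  measurable_fun [set: Rn R n] (@std_normal_pdf R n).
Proof.
apply: measurable_funM => //; apply: measurableT_comp => //.
apply: measurableT_comp => //; apply: measurable_funM => //.
by apply: measurable_inner => i; exact: measurable_tnth.
Qed.

Lemma std_normal_pdf_gt0 (R : realType) (n : nat) (t : Rn R n) :
  0 < std_normal_pdf t.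
Proof.
by rewrite mulr_gt0 ?expR_gt0// powR_gt0// mulr_gt0// pi_gt0.
Qed.

Lemma std_normal_pdf_opp (R : realType) (n : nat) (t : Rn R n) :
  std_normal_pdf (tuple_opp t) = std_normal_pdf t.
Proof. by rewrite /std_normal_pdf inner_oppl inner_oppr opprK. Qed.

Lemma std_normal_pdf_cons (R : realType) (n : nat) (x : R) (t : Rn R n) :
  std_normal_pdf (cons_pair (x, t)) = normal_pdf 0 1 x * std_normal_pdf t.
Proof.
have pi2 : 0 < 2 * pi :> R by rewrite mulr_gt0// pi_gt0.
rewrite /std_normal_pdf normal_pdfE ?oner_eq0// /normal_peak /normal_fun.
have -> : inner (cons_pair (x, t)) (cons_pair (x, t)) = x ^+ 2 + inner t t.
  rewrite /inner big_ord_recl; congr (_ + _).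
  by apply: eq_bigr => i _; rewrite !tnthS.
have -> : - ((x ^+ 2 + inner t t) / 2) =
    - (x - 0) ^+ 2 / (1 ^+ 2 *+ 2) + - (inner t t / 2) :> R.
  by rewrite subr0 expr1n; lra.
rewrite expRD.
have -> : - (n.+1%:R / 2) = - 2^-1 + - (n%:R / 2) :> R by rewrite -natr1; lra.
rewrite powRD ?(gt_eqF pi2) ?implybT//.
have -> : (Num.sqrt (1 ^+ 2 * pi *+ 2))^-1 = (2 * pi) `^ (- 2^-1) :> R.
  by rewrite powRN powR12_sqrt ?ltW// expr1n mul1r mulr_natl.
by rewrite !mulrA; congr (_ * _); rewrite mulrAC.
Qed.

(** * Integration on tuples: Tonelli, reflection, Gaussian mass *)

Lemma ge0_integral_lebesgue_opp (R : realType) (F : R -> \bar R) :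
    measurable_fun [set: R] F -> (forall x, 0 <= F x)%E ->
  (\int[@lebesgue_measure R]_x F (- x)%R = \int[@lebesgue_measure R]_x F x)%E.
Proof.
move=> mF F0; pose opp : measurableTypeR R -> measurableTypeR R := -%R.
have mopp : measurable_fun setT opp by exact: measurable_funN.
have /= := @ge0_integral_pushforward _ _ _ _ R opp mopp
  (@lebesgue_measure R) setT F measurableT mF (fun x _ => F0 x).
rewrite preimage_setT => <-; apply/esym/eq_measure_integral => A mA _.
exact/esym/lebesgue_measureN.
Qed.

(** Change of variables along [cons_pair], followed by Tonelli for the product measure; it allows
    integrals to be treated by induction on the dimension. *)
Lemma ge0_integral_lebesgue_tupleS (R : realType) (n : nat)
    (F : Rn R n.+1 -> \bar R) :
    measurable_fun setT F -> (forall t, 0 <= F t)%E ->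
  (\int[lebesgue_tuple R n.+1]_t F t =
   \int[@lebesgue_measure R]_x \int[lebesgue_tuple R n]_t
     F (cons_pair (x, t)))%E.
Proof.
move=> mF F0.
have mc := @measurable_cons_pair R n.
rewrite -[RHS](fubini_tonelli1 (m1 := @lebesgue_measure R)
    (m2 := lebesgue_tuple R n) (F \o @cons_pair R n)) /=; first last.
- by move=> ?; exact: F0.
- exact: measurableT_comp.
have /= := @ge0_integral_pushforward _ _ _ _ R _ mc
  (@lebesgue_measure R \x lebesgue_tuple R n)%E setT F measurableT mF
  (fun x _ => F0 x).
by rewrite preimage_setT => <-.
Qed.

Lemma ge0_integral_lebesgue_tuple_opp (R : realType) (n : nat)
    (F : Rn R n -> \bar R) :
    measurable_fun setT F -> (forall t, 0 <= F t)%E ->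
  (\int[lebesgue_tuple R n]_t F (tuple_opp t) =
   \int[lebesgue_tuple R n]_t F t)%E.
Proof.
elim: n F => [|n IHn] F mF F0.
  by apply: eq_integral => t _; congr F; rewrite (tuple0 t) [LHS]tuple0.
have mFo : measurable_fun setT (F \o @tuple_opp R n.+1).
  by apply: measurableT_comp => //; exact: measurable_tuple_opp.
have mFc : measurable_fun setT (F \o @cons_pair R n).
  by apply: measurableT_comp => //; exact: measurable_cons_pair.
rewrite !ge0_integral_lebesgue_tupleS//.
(* Reflect the head and the tail separately: [G] integrates out the tail, so the one-dimensional
   case applies to [G], and the induction hypothesis applies to the tail at the fixed head [- x]. *)
pose G x := (\int[lebesgue_tuple R n]_t F (cons_pair (x, t)))%E.
transitivity (\int[@lebesgue_measure R]_x G (- x)%R)%E; last first.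
  apply: ge0_integral_lebesgue_opp => [|x]; last exact: integral_ge0.
  apply: (measurable_fun_fubini_tonelli_F (m2 := lebesgue_tuple R n)
    (F \o @cons_pair R n)) => // xt; exact: F0.
apply: eq_integral => x _.
rewrite [RHS](esym (IHn (fun t => F (cons_pair (- x, t))) _ _))//.
  by apply: eq_integral => t _; congr F; apply: val_inj.
exact: (measurableT_comp mFc (measurable_pair1 _)).
Qed.

Lemma integral_std_normal_pdf (R : realType) (n : nat) :
  (\int[lebesgue_tuple R n]_t (std_normal_pdf t)%:E = 1)%E.
Proof.
elim: n => [|n IHn].
  rewrite integral_dirac//; last first.
    by apply/measurable_EFinP; exact: measurable_std_normal_pdf.
  rewrite diracT mul1e /std_normal_pdf /inner big_ord0.
  by rewrite !mul0r oppr0 powRr0 expR0 mulr1.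
rewrite ge0_integral_lebesgue_tupleS; first last.
- by move=> t; rewrite lee_fin ltW// std_normal_pdf_gt0.
- by apply/measurable_EFinP; exact: measurable_std_normal_pdf.
rewrite -[RHS](@integral_normal_pdf R 0 1).
apply: eq_integral => x _; under eq_integral do rewrite std_normal_pdf_cons EFinM.
rewrite ge0_integralZl ?IHn ?mule1//.
- by apply/measurable_EFinP; exact: measurable_std_normal_pdf.
- by move=> t _; rewrite lee_fin ltW// std_normal_pdf_gt0.
- by rewrite lee_fin normal_pdf_ge0.
Qed.

(** On a null space every integral vanishes, whereas the Gaussian density integrates to 1. *)
Lemma lebesgue_tupleT_neq0 (R : realType) (n : nat) :
  lebesgue_tuple R n setT != 0%E.
Proof.
apply/eqP => T0; have := @integral_std_normal_pdf R n.
rewrite null_set_integral// => [/eqP|].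
- by rewrite eq_sym onee_eq0.
- by apply/measurable_EFinP; exact: measurable_std_normal_pdf.
Qed.

(** A zero integral would force [F] to vanish almost everywhere; as [F] vanishes nowhere, the
    exceptional null set would be the whole space. *)
Lemma Rintegral_gt0 (d : measure_display) (T : measurableType d)
    (R : realType) (mu : {measure set T -> \bar R}) (F : T -> R) :
    mu.-integrable setT (EFin \o F) -> (forall t, 0 < F t) ->
    mu setT != 0%E ->
  0 < \int[mu]_t F t.
Proof.
move=> iF F0 muT; rewrite lt_neqAle; apply/andP; split; last first.
  by apply: Rintegral_ge0 => t _; exact/ltW.
apply/negP => /eqP int0; move/negP: muT; apply.
have mF := measurable_int mu iF.
have absF0 : (\int[mu]_t `|(EFin \o F) t| = 0)%E.
  transitivity (\int[mu]_t (F t)%:E)%E.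
    by apply: eq_integral => t _; rewrite /= gtr0_norm.
  by rewrite -[LHS]fineK ?[X in X%:E](esym int0)//; exact: integrable_fin_num.
have [N [mN N0 subN]] := (ae_eq_integral_abs mu measurableT mF).1 absF0.
suff <- : N = setT by apply/eqP.
apply/seteqP; split => // t _; apply: subN => /= /(_ I) [] /eqP.
by rewrite gt_eqF.
Qed.

(** * The predictive probability as a function of the fixed effect *)

Section strictly_increasing_link.
Context (R : realType) (k : nat) (h : R -> R) (b : Rn R k).
Hypothesis h01 : forall u, 0 < h u < 1.
Hypothesis h_incr : forall u v, u < v -> h u < h v.

Let prob (a : R) : R :=
  \int[lebesgue_tuple R k]_t (h (a + inner b t) * std_normal_pdf t).

Let measurable_mean (a : R) :
  measurable_fun [set: Rn R k] (fun t => h (a + inner b t)).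
Proof.
apply: (@measurableT_comp _ _ _ _ _ _ h).
  (* Monotonicity alone makes [h] Borel. *)
  by apply: nondecreasing_measurable => // u v; rewrite le_eqVlt =>
    /predU1P[->//|/h_incr/ltW].
apply: measurable_funD => //.
by apply: measurable_inner => i //; exact: measurable_tnth.
Qed.

Let measurable_mean_pdf (a : R) :
  measurable_fun [set: Rn R k] (fun t => h (a + inner b t) * std_normal_pdf t).
Proof.
by apply: measurable_funM => //; exact: measurable_std_normal_pdf.
Qed.

Let integrable_pdf : (lebesgue_tuple R k).-integrable setT
  (EFin \o @std_normal_pdf R k).
Proof.
apply/integrableP; split.
  by apply/measurable_EFinP; exact: measurable_std_normal_pdf.
rewrite (eq_integral (EFin \o @std_normal_pdf R k)) => [|t _].
  by rewrite integral_std_normal_pdf ltry.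
by rewrite /= ger0_norm// ltW// std_normal_pdf_gt0.
Qed.

Let integrable_mean_pdf (a : R) : (lebesgue_tuple R k).-integrable setT
  (fun t => (h (a + inner b t) * std_normal_pdf t)%:E).
Proof.
(* Since [0 < h < 1], the Gaussian density dominates the integrand. *)
apply: le_integrable integrable_pdf => //; first exact/measurable_EFinP.
move=> t _ /=; have p0 := @std_normal_pdf_gt0 R k t.
have /andP[h0 h1] := h01 (a + inner b t).
rewrite lee_fin (ger0_norm (ltW p0)) ger0_norm; first by rewrite ger_pMl// ltW.
by rewrite ltW// mulr_gt0.
Qed.

(** The difference is the integral of an everywhere positive function over a space of nonzero
    measure, which makes the inequality strict. *)
Lemma prob_incr (a a' : R) : a < a' -> prob a < prob a'.
Proof.
move=> aa'; rewrite -subr_gt0 -RintegralB; [|by []|exact: integrable_mean_pdf..].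
apply: Rintegral_gt0 => [|t|].
- have := integrableB measurableT (integrable_mean_pdf a') (integrable_mean_pdf a).
  by apply: eq_integrable.
- by rewrite -mulrBl mulr_gt0 ?std_normal_pdf_gt0// subr_gt0 h_incr// ltrD2r.
- exact: lebesgue_tupleT_neq0.
Qed.

Lemma prob_compl (a : R) : (forall u, 1 - h u = h (- u)) ->
  1 - prob a = prob (- a).
Proof.
move=> h_sym.
(* Writing 1 as the Gaussian mass brings the complement under the integral. *)
have -> : 1 = \int[lebesgue_tuple R k]_t std_normal_pdf t.
  by rewrite /Rintegral integral_std_normal_pdf.
rewrite -RintegralB; [|by []|exact: integrable_pdf|exact: integrable_mean_pdf].
rewrite /prob /Rintegral; congr fine.
(* After reflecting [t] on the right, the argument of [h] is the opposite of [a + inner b t], as in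
   [h_sym]. *)
rewrite -[RHS]ge0_integral_lebesgue_tuple_opp.
- apply: eq_integral => t _; congr EFin.
  rewrite inner_oppr std_normal_pdf_opp -[X in X - _]mul1r -mulrBl h_sym.
  by rewrite opprD.
- exact/measurable_EFinP.
- move=> t; have /andP[h0 _] := h01 (- a + inner b t).
  by rewrite lee_fin ltW// mulr_gt0// std_normal_pdf_gt0.
Qed.

End strictly_increasing_link.

Theorem proposition2 (R : realType) (eta etainv : R -> R)
    (eta_link : inverse_link eta etainv)
    (etainv_incr : forall u v : R, u < v -> etainv u < etainv v)
    (etainv_sym : forall u : R, 1 - etainv u = etainv (- u)) :
  exists D : R -> set bool,
    (forall u : R, D u !=set0) /\
    (forall (p q k : nat) (f : Rn R p -> R) (g : Rn R q -> Rn R k)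
            (x : Rn R p) (z : Rn R q),
       bayes_classifier etainv f g x z = D (f x)).
Proof.
have [h01 _ _] := eta_link.
(* At [u = 0] the two responses tie and both belong to the set. *)
exists (fun u => [set c : bool | if c then 0 <= u else u <= 0]); split.
  by move=> u; have [u0|/ltW u0] := leP 0 u; [exists true|exists false].
move=> p q k f g x z.
have prob_mono := le_mono (@prob_incr R k etainv (g z) h01 etainv_incr).
have prob0 := @prob_compl R k etainv (g z) h01 etainv_incr (f x) etainv_sym.
have le10 : (new_group_prob etainv f g x z false <=
    new_group_prob etainv f g x z true) = (0 <= f x).
  (* By [prob0] and [prob_mono] the comparison reduces to [- f x <= f x]. *)
  by rewrite /= /new_group_prob1 /cond_mean prob0 prob_mono; lra.
have le01 : (new_group_prob etainv f g x z true <=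
    new_group_prob etainv f g x z false) = (f x <= 0).
  by rewrite /= /new_group_prob1 /cond_mean prob0 prob_mono; lra.
apply/seteqP; split => -[] /=; rewrite /bayes_classifier /=.
- by move=> /(_ false); rewrite le10.
- by move=> /(_ true); rewrite le01.
- by move=> f0 [] //; rewrite le10.
- by move=> f0 [] //; rewrite le01.
Qed.
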